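(* Let $M>0$ and $\alpha\in(0,1]$, and let $f=h+\overline{g}\in\mathcal{P}_{\mathcal{H}}^0(\alpha,M)$ with $h(z)=z+\sum_{n=2}^\infty a_nz^n$ and $g(z)=\sum_{n=2}^\infty b_nz^n$ for $z\in\mathbb{D}$. Then for every $n\geq 2$: (i) $|a_n|+|b_n|\leq \dfrac{2(M-\alpha+1)}{n+\alpha n(n-2)}$; (ii) $\big||a_n|-|b_n|\big|\leq \dfrac{2(M-\alpha+1)}{n+\alpha n(n-2)}$; (iii) $|a_n|\leq \dfrac{2(M-\alpha+1)}{n+\alpha n(n-2)}$. The results are sharp: the function $f(z)=z+\sum_{n=2}^\infty \frac{2(M-\alpha+1)}{n+\alpha n(n-2)}z^n$ belongs to $\mathcal{P}_{\mathcal{H}}^0(\alpha,M)$ and attains equality in (i), (ii) and (iii).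
   Context: $\mathbb{D}=\{z\in\mathbb{C}:|z|<1\}$. $\mathcal{H}$ is the class of complex-valued harmonic functions $f=h+\overline{g}$ in $\mathbb{D}$, with $h,g$ analytic in $\mathbb{D}$ and $h(0)=h'(0)-1=0$, $g(0)=0$. For $M>0$ and $\alpha\in(0,1]$, $\mathcal{P}_{\mathcal{H}}^0(\alpha,M)$ is the class of all $f=h+\overline{g}\in\mathcal{H}$ with $g'(0)=0$ and $$\mathrm{Re}\left((1-\alpha)h'(z)+\alpha zh''(z)\right)>-M+\left|(1-\alpha)g'(z)+\alpha zg''(z)\right|\quad\text{for all } z\in\mathbb{D}.$$ *)

(* Defs.v *)
From Stdlib Require Export Reals.
From Coquelicot Require Export Coquelicot.
Open Scope R_scope.

Definition disk (z : C) : Prop := Cmod z < 1.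

(* Analytic in the unit disk: complex-differentiable (over [C_AbsRing], not
   merely over [R]) at every point of the disk. *)
Definition analytic (f : C -> C) : Prop :=
  forall z : C, disk z -> @ex_derive C_AbsRing C_NormedModule f z.

(* [f = h + conj g] with the normalisation h(0) = h'(0) - 1 = g(0) = 0.  Harmonicity of
   [f] is automatic from analyticity of [h] and [g], and these normalisations
   determine [h] and [g] on the disk.  Values outside the disk are irrelevant. *)
Definition canonical_rep (f h g : C -> C) : Prop :=
  analytic h /\ analytic g /\
  h (RtoC 0) = RtoC 0 /\ C_derive h (RtoC 0) = RtoC 1 /\ g (RtoC 0) = RtoC 0 /\
  forall z : C, disk z -> f z = (h z + Cconj (g z))%C.

(* (1 - alpha) u'(z) + alpha z u''(z).  [C_derive] is a total function that
   agrees with the complex derivative wherever the latter exists; for analytic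
   [u] the first and second derivatives exist throughout the disk. *)
Definition diff_op (alpha : R) (u : C -> C) (z : C) : C :=
  (RtoC (1 - alpha) * C_derive u z
   + RtoC alpha * z * C_derive (C_derive u) z)%C.

(* Membership is a property of [f] alone, via its decomposition on the disk. *)
Definition class_P0 (alpha M : R) (f : C -> C) : Prop :=
  exists h g : C -> C,
    canonical_rep f h g /\
    C_derive g (RtoC 0) = RtoC 0 /\
    forall z : C, disk z ->
      Re (diff_op alpha h z) > - M + Cmod (diff_op alpha g z).

Definition has_expansion (u : C -> C) (a : nat -> C) : Prop :=
  forall z : C, disk z -> @is_pseries C_AbsRing C_NormedModule a z (u z).

Definition coef_bound (alpha M : R) (n : nat) : R :=
  2 * (M - alpha + 1) / (INR n + alpha * INR n * (INR n - 2)).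

Definition extremal_coef (alpha M : R) (n : nat) : C :=
  match n with
  | O => RtoC 0
  | S O => RtoC 1
  | _ => RtoC (coef_bound alpha M n)
  end.

(* Main.v *)
(** The coefficients of [diff_op alpha u] are [(1 - alpha + alpha m) (m + 1) a_(m+1)].  For
    every unimodular [v] the function [M + diff_op alpha h + v diff_op alpha g] has
    nonnegative real part and, since [g'(0) = 0], value [M - alpha + 1] at the origin,
    so Caratheodory's inequality [|p_m| <= 2 Re p_0] bounds [|a_n + v b_n|]; choosing [v] to
    align the phases gives [|a_n| + |b_n|].  Caratheodory's inequality itself is obtained
    by averaging [Re P] over roots of unity on a circle, where [P] is a partial sum, against
    the nonnegative weight [1 + Re (v e^(-int))].  Only the derivatives of [h] and
    [g] matter, and those are determined by [f]: a holomorphic function with holomorphic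
    conjugate has zero derivative.  For the extremal function [diff_op alpha f] is
    [1 - alpha + 2 c z / (1 - z)] with [c = M - alpha + 1], and
    [Re (z / (1 - z)) > - 1 / 2]. *)

From Stdlib Require Import Arith Lra Lia ClassicalEpsilon.
Require Import Defs.

(** * Complex power series and their termwise derivatives *)

Notation C_series := (@is_series C_AbsRing C_NormedModule).

(* Replaces the carrier of a Coquelicot structure by the underlying type, so that [ring] applies. *)
Ltac at_type T := match goal with |- ?x = ?y => change (@eq T x y) end.

(** The triangle inequality bounds each finite block of terms after [N]; letting the block grow
    gives the tail. Since [v] can depend on the radius alone, this makes truncation errors uniform
    on a circle. *)
Lemma norm_series_tail (u : nat -> C) (v : nat -> R) (l : C) (s : R) (N : nat) :
  (forall n, Cmod (u n) <= v n) -> C_series u l -> is_series v s ->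
  Cmod (l - @sum_n C_AbelianMonoid u N) <= s - sum_n v N.
Proof.
intros Huv Hu Hv.
apply le_epsilon; intros eps Heps.
assert (Heps2 : 0 < eps / 2) by lra.
destruct (proj1 (filterlim_locally_ball_norm _ _) Hu (mkposreal _ Heps2)) as [N1 H1].
destruct (proj1 (filterlim_locally_ball_norm _ _) Hv (mkposreal _ Heps2)) as [N2 H2].
set (m := Nat.max (S N) (Nat.max N1 N2)).
assert (H3 : Cmod (@sum_n C_AbelianMonoid u m - l) < eps / 2) by (apply (H1 m); lia).
assert (H4 : Rabs (sum_n v m - s) < eps / 2) by (apply (H2 m); lia).
apply Rabs_lt_between in H4.
assert (H5 : @sum_n C_AbelianMonoid u m
             = (@sum_n C_AbelianMonoid u N + @sum_n_m C_AbelianMonoid u (S N) m)%C).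
{ unfold sum_n. apply (sum_n_m_Chasles (G := C_AbelianMonoid) u 0 N m); lia. }
assert (H6 : sum_n v m = sum_n v N + sum_n_m v (S N) m).
{ unfold sum_n. apply (sum_n_m_Chasles (G := R_AbelianMonoid) v 0 N m); lia. }
assert (H7 : Cmod (@sum_n_m C_AbelianMonoid u (S N) m) <= sum_n_m v (S N) m).
{ eapply Rle_trans.
  - apply (norm_sum_n_m (V := C_NormedModule) u (S N) m).
  - apply sum_n_m_le. exact Huv. }
replace (l - @sum_n C_AbelianMonoid u N)%C
  with (- (@sum_n C_AbelianMonoid u m - l) + @sum_n_m C_AbelianMonoid u (S N) m)%C
  by (rewrite H5; ring).
eapply Rle_trans; [apply Cmod_triangle|].
rewrite Cmod_opp. lra.
Qed.

Lemma norm_series_le (u : nat -> C) (v : nat -> R) (l : C) (s : R) :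
  (forall n, Cmod (u n) <= v n) -> C_series u l -> is_series v s -> Cmod l <= s.
Proof.
intros Huv Hu Hv.
assert (H := norm_series_tail u v l s 0 Huv Hu Hv).
rewrite !sum_O in H.
replace l with ((l - u O) + u O)%C by ring.
eapply Rle_trans; [apply Cmod_triangle|].
specialize (Huv O). lra.
Qed.

Lemma C_pow_n (z : C) (n : nat) : @pow_n C_AbsRing z n = (z ^ n)%C.
Proof. induction n as [|n IH]; [reflexivity|exact (f_equal (Cmult z) IH)]. Qed.

Lemma is_pseries_C (a : nat -> C) (z l : C) :
  @is_pseries C_AbsRing C_NormedModule a z l <-> C_series (fun n => a n * z ^ n)%C l.
Proof.
unfold is_pseries.
split; apply is_series_ext; intros n; rewrite (C_pow_n z n); apply Cmult_comm.
Qed.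

(** A late term is the difference of two partial sums within 1 of the limit, hence the bound 2;
    finitely many terms remain. *)
Lemma C_series_terms_bounded (u : nat -> C) (l : C) :
  C_series u l -> exists B, forall n, Cmod (u n) <= B.
Proof.
intros Hu.
destruct (proj1 (filterlim_locally_ball_norm _ _) Hu (mkposreal _ Rlt_0_1)) as [N HN].
assert (HN' : forall n, (N <= n)%nat -> Cmod (@sum_n C_AbelianMonoid u n - l) < 1)
  by (intros n Hn; apply (HN n Hn)).
assert (Hlarge : forall n, (S N <= n)%nat -> Cmod (u n) <= 2).
{ intros [|n] Hn; [lia|].
  replace (u (S n)) with
    ((@sum_n C_AbelianMonoid u (S n) - l) + - (@sum_n C_AbelianMonoid u n - l))%C.
  2:{ rewrite sum_Sn. change plus with Cplus. ring. }
  eapply Rle_trans; [apply Cmod_triangle|]. rewrite Cmod_opp.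
  assert (H1 := HN' (S n) ltac:(lia)). assert (H2 := HN' n ltac:(lia)). lra. }
assert (Hsmall : forall k, exists B, forall n, (n < k)%nat -> Cmod (u n) <= B).
{ induction k as [|k [B HB]].
  - exists 0. intros n Hn. lia.
  - exists (Rmax B (Cmod (u k))). intros n Hn.
    destruct (Nat.eq_dec n k) as [->|Hne].
    + apply Rmax_r.
    + eapply Rle_trans; [apply HB; lia|apply Rmax_l]. }
destruct (Hsmall (S N)) as [B HB].
exists (Rmax B 2). intros n.
destruct (Nat.lt_ge_cases n (S N)) as [Hn|Hn].
- eapply Rle_trans; [apply HB; exact Hn|apply Rmax_l].
- eapply Rle_trans; [apply Hlarge; exact Hn|apply Rmax_r].
Qed.

(** Convergence at the midpoint [rho] of [r] and 1 bounds the terms there, so the real series of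
    moduli has radius at least [rho]. This gives access to the theory of real power series. *)
Lemma expansion_CV_radius (u : C -> C) (a : nat -> C) (r : R) :
  has_expansion u a -> 0 <= r < 1 -> Rbar_lt (Rabs r) (CV_radius (fun n => Cmod (a n))).
Proof.
intros Ha Hr.
set (rho := (1 + r) / 2).
assert (Hrho : 0 <= rho < 1 /\ r < rho) by (unfold rho; lra).
assert (Hd : disk rho).
{ unfold disk. rewrite Cmod_R, Rabs_pos_eq; lra. }
destruct (C_series_terms_bounded _ _ (proj1 (is_pseries_C a rho _) (Ha _ Hd))) as [B HB].
apply Rbar_lt_le_trans with rho.
- simpl. rewrite Rabs_pos_eq; lra.
- apply (proj1 (CV_radius_bounded (fun n => Cmod (a n)))).
  exists B. intros n.
  generalize (HB n). rewrite Cmod_mult, Cmod_pow, Cmod_R.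
  rewrite Rabs_mult, (Rabs_pos_eq (Cmod _)) by apply Cmod_ge_0.
  rewrite RPow_abs. tauto.
Qed.

Lemma ex_series_abs_expansion (u : C -> C) (a : nat -> C) (r : R) :
  has_expansion u a -> 0 <= r < 1 -> ex_series (fun n => Cmod (a n) * r ^ n).
Proof.
intros Ha Hr.
generalize (CV_disk_inside _ _ (expansion_CV_radius u a r Ha Hr)).
apply ex_series_ext. intros n.
apply Rabs_pos_eq, Rmult_le_pos; [apply Cmod_ge_0|apply pow_le; lra].
Qed.

(** Formal differentiation preserves the radius, and this is the second derivative of the modulus
    series, shifted by two. Its terms are the remainder bounds of [Cmod_pow_taylor1]; those of index
    0 and 1 vanish. *)
Lemma ex_series_abs_derive2 (u : C -> C) (a : nat -> C) (r : R) :
  has_expansion u a -> 0 <= r < 1 ->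
  ex_series (fun n => Cmod (a n) * (INR n * INR (n - 1) * r ^ (n - 2))).
Proof.
intros Ha Hr.
apply (ex_series_incr_n (V := R_NormedModule) _ 2).
assert (H := expansion_CV_radius u a r Ha Hr).
rewrite <- CV_radius_derive, <- CV_radius_derive in H.
generalize (CV_disk_inside _ _ H).
apply ex_series_ext. intros n. unfold PS_derive.
rewrite Rabs_pos_eq.
- replace (2 + n - 1)%nat with (S n) by lia.
  replace (2 + n - 2)%nat with n by lia.
  replace (2 + n)%nat with (S (S n)) by lia. at_type R. ring.
- apply Rmult_le_pos; [|apply pow_le; lra].
  repeat apply Rmult_le_pos; try apply pos_INR. apply Cmod_ge_0.
Qed.

(** Induction on the identity R_(n+1) = w R_n + n z^(n-1) (w - z)^2 for the remainder R_n. The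
    constant n (n - 1) is twice the optimal one, which keeps the induction free of divisions. *)
Lemma Cmod_pow_taylor1 (w z : C) (r : R) (n : nat) :
  Cmod w <= r -> Cmod z <= r ->
  Cmod (w ^ n - z ^ n - INR n * z ^ (n - 1) * (w - z))
  <= INR n * INR (n - 1) * r ^ (n - 2) * Cmod (w - z) ^ 2.
Proof.
intros Hw Hz.
assert (Hr : 0 <= r) by (generalize (Cmod_ge_0 w); lra).
destruct n as [|n].
{ simpl. replace (1 - 1 - 0 * 1 * (w - z))%C with (RtoC 0) by ring. rewrite Cmod_0. lra. }
destruct n as [|n].
{ simpl. replace (w * 1 - z * 1 - 1 * 1 * (w - z))%C with (RtoC 0) by ring. rewrite Cmod_0. lra. }
replace (S (S n) - 1)%nat with (S n) by lia.
replace (S (S n) - 2)%nat with n by lia.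
induction n as [|n IH].
- replace (w ^ 2 - z ^ 2 - INR 2 * z ^ 1 * (w - z))%C with ((w - z) ^ 2)%C
    by (simpl; rewrite RtoC_plus; ring).
  rewrite Cmod_pow. simpl INR. assert (H := pow2_ge_0 (Cmod (w - z))). simpl pow at 2. lra.
- replace (w ^ S (S (S n)) - z ^ S (S (S n)) - INR (S (S (S n))) * z ^ S (S n) * (w - z))%C
    with (w * (w ^ S (S n) - z ^ S (S n) - INR (S (S n)) * z ^ S n * (w - z))
          + INR (S (S n)) * z ^ S n * (w - z) ^ 2)%C.
  2:{ rewrite (S_INR (S (S n))), RtoC_plus. simpl Cpow. ring. }
  eapply Rle_trans; [apply Cmod_triangle|].
  rewrite !Cmod_mult, !Cmod_pow, Cmod_R, (Rabs_pos_eq (INR _)) by apply pos_INR.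
  set (d := Cmod (w - z) ^ 2) in *.
  assert (Hd : 0 <= d) by apply pow2_ge_0.
  assert (Hzn : Cmod z ^ S n <= r ^ S n) by (apply pow_incr; split; [apply Cmod_ge_0|lra]).
  set (D := Cmod (w ^ S (S n) - z ^ S (S n) - INR (S (S n)) * z ^ S n * (w - z))) in *.
  assert (HD : Cmod w * D <= r * (INR (S (S n)) * INR (S n) * r ^ n * d)).
  { apply Rmult_le_compat; [apply Cmod_ge_0|apply Cmod_ge_0|exact Hw|exact IH]. }
  assert (HE : INR (S (S n)) * Cmod z ^ S n * d <= INR (S (S n)) * r ^ S n * d).
  { apply Rmult_le_compat_r; [exact Hd|].
    apply Rmult_le_compat_l; [apply pos_INR|exact Hzn]. }
  eapply Rle_trans; [apply Rplus_le_compat; [exact HD|exact HE]|].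
  assert (HP : 0 <= r ^ S n * d) by (apply Rmult_le_pos; [apply pow_le; exact Hr|exact Hd]).
  assert (HN := pos_INR n).
  rewrite !S_INR. simpl pow in *.
  (* With N = n + 2, the target constant (N + 1) N exceeds the accumulated N (N - 1) + N by exactly
     N. *)
  assert (HQ : 0 <= (INR n + 2) * (r * r ^ n * d)) by (apply Rmult_le_pos; lra).
  nra.
Qed.

Lemma is_derive_C_quadratic (f : C -> C) (z l : C) (K d : R) :
  0 < d ->
  (forall w, Cmod (w - z) < d -> Cmod (f w - f z - l * (w - z)) <= K * Cmod (w - z) ^ 2) ->
  @is_derive C_AbsRing C_NormedModule f z l.
Proof.
intros Hd H.
assert (HK := Rabs_pos K).
split; [apply is_linear_scal_l|].
intros x Hx.
(* [is_derive] quantifies over every limit point of the neighbourhood filter of [z]; by separation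
   there is only [z]. *)
rewrite <- (is_filter_lim_locally_unique (V := AbsRing_NormedModule C_AbsRing) _ _ Hx).
intros eps.
(* The denominator [Rabs K + 1] is positive whatever the sign of [K]. *)
assert (He : 0 < Rmin d (eps / (Rabs K + 1))).
{ apply Rmin_pos; [exact Hd|]. apply Rdiv_lt_0_compat; [apply cond_pos|lra]. }
exists (mkposreal _ He). intros w Hw.
change (Cmod (w - z) < Rmin d (eps / (Rabs K + 1))) in Hw.
change (Cmod (f w - f z - (w - z) * l) <= eps * Cmod (w - z)).
rewrite (Cmult_comm (w - z)).
eapply Rle_trans; [apply H|].
- eapply Rlt_le_trans; [exact Hw|apply Rmin_l].
- assert (H1 : Cmod (w - z) < eps / (Rabs K + 1)) by (eapply Rlt_le_trans; [exact Hw|apply Rmin_r]).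
  assert (H2 := Cmod_ge_0 (w - z)).
  assert (H3 : (Rabs K + 1) * Cmod (w - z) < eps).
  { apply Rmult_lt_reg_r with (/ (Rabs K + 1)); [apply Rinv_0_lt_compat; lra|].
    replace ((Rabs K + 1) * Cmod (w - z) * / (Rabs K + 1)) with (Cmod (w - z)) by (field; lra).
    exact H1. }
  assert (H4 := Rle_abs K). simpl. nra.
Qed.

Definition C_PS_derive (a : nat -> C) (n : nat) : C := (INR (S n) * a (S n))%C.

Lemma C_PS_derive_convergent (u : C -> C) (a : nat -> C) (z : C) :
  has_expansion u a -> disk z ->
  exists l, @is_pseries C_AbsRing C_NormedModule (C_PS_derive a) z l.
Proof.
intros Ha Hz.
assert (Hr : 0 <= Cmod z < 1) by (split; [apply Cmod_ge_0|exact Hz]).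
assert (H := expansion_CV_radius u a _ Ha Hr).
rewrite <- CV_radius_derive in H.
destruct (ex_series_le (V := C_CompleteNormedModule) (fun n => C_PS_derive a n * z ^ n)%C
            (fun n => Rabs (PS_derive (fun n => Cmod (a n)) n * Cmod z ^ n))) as [l Hl].
- intros n. change (Cmod (C_PS_derive a n * z ^ n)
                    <= Rabs (PS_derive (fun n => Cmod (a n)) n * Cmod z ^ n)).
  unfold C_PS_derive, PS_derive.
  rewrite !Cmod_mult, Cmod_pow, Cmod_R, !Rabs_mult.
  rewrite (Rabs_pos_eq (Cmod _)), (Rabs_pos_eq (Cmod z ^ n))
    by (try apply pow_le; apply Cmod_ge_0).
  apply Rle_refl.
- apply CV_disk_inside. exact H.
- exists l. apply is_pseries_C. exact Hl.
Qed.

(** The Taylor remainders of the monomials, weighted by the coefficients, sum to at most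
    [K * Cmod (w - z) ^ 2] on the closed disk of radius [r], halfway between [Cmod z] and 1. *)
Lemma is_derive_expansion (u : C -> C) (a : nat -> C) (z l : C) :
  has_expansion u a -> disk z ->
  @is_pseries C_AbsRing C_NormedModule (C_PS_derive a) z l ->
  @is_derive C_AbsRing C_NormedModule u z l.
Proof.
intros Ha Hz Hl.
set (r := (1 + Cmod z) / 2).
assert (Hz0 := Cmod_ge_0 z). unfold disk in Hz.
assert (Hr : 0 <= r < 1) by (unfold r; lra).
destruct (ex_series_abs_derive2 u a r Ha Hr) as [K HK].
(* Reindexed so that the n-th term belongs to z^n; the added term of index 0 is zero. *)
assert (Hl' : C_series (fun n => a n * (INR n * z ^ (n - 1)))%C l).
{ apply is_pseries_C in Hl.
  generalize (is_series_decr_1 (V := C_NormedModule)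
    (fun n => a n * (INR n * z ^ (n - 1)))%C l).
  intros H1. apply H1. clear H1.
  match goal with |- is_series _ ?x => replace x with l end.
  2:{ at_type C. change plus with Cplus. change opp with Copp. simpl. ring. }
  revert Hl. apply is_series_ext. intros n. unfold C_PS_derive.
  replace (S n - 1)%nat with n by lia. at_type C. ring. }
(* As 1 - r = r - |z|, every [w] this close to [z] satisfies |w| <= r. *)
apply is_derive_C_quadratic with (K := K) (d := 1 - r).
- lra.
- intros w Hw.
  assert (Hwr : Cmod w <= r).
  { replace w with ((w - z) + z)%C by ring.
    eapply Rle_trans; [apply Cmod_triangle|]. unfold r in *. lra. }
  assert (Hzr : Cmod z <= r) by (unfold r; lra).
  assert (Hw1 : disk w) by (unfold disk; lra).
  assert (Hsum : C_series (fun n => a n * (w ^ n - z ^ n - INR n * z ^ (n - 1) * (w - z)))%C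
                   (u w - u z - l * (w - z))%C).
  { assert (H := is_series_minus (V := C_NormedModule) _ _ _ _
      (is_series_minus (V := C_NormedModule) _ _ _ _
         (proj1 (is_pseries_C _ _ _) (Ha w Hw1)) (proj1 (is_pseries_C _ _ _) (Ha z Hz)))
      (is_series_scal (V := C_NormedModule) (w - z)%C _ _ Hl')).
    rewrite (Cmult_comm l).
    revert H. apply is_series_ext. intros n.
    change ((a n * w ^ n - a n * z ^ n - (w - z) * (a n * (INR n * z ^ (n - 1))))%C
            = (a n * (w ^ n - z ^ n - INR n * z ^ (n - 1) * (w - z)))%C). ring. }
  refine (norm_series_le _
    (fun n => Cmod (w - z) ^ 2 * (Cmod (a n) * (INR n * INR (n - 1) * r ^ (n - 2)))) _
    _ _ Hsum _).
  + intros n. rewrite Cmod_mult.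
    assert (H := Cmod_pow_taylor1 w z r n Hwr Hzr).
    assert (H0 := Cmod_ge_0 (a n)). nra.
  + rewrite (Rmult_comm K). apply (is_series_scal (V := R_NormedModule)), HK.
Qed.

(** * Holomorphic functions on the disk *)

Lemma locally_disk (z : C) : disk z -> @locally (AbsRing_UniformSpace C_AbsRing) z disk.
Proof.
intros Hz. unfold disk in *.
assert (Hd : 0 < 1 - Cmod z) by lra.
exists (mkposreal _ Hd). intros w Hw.
change (Cmod (w - z) < 1 - Cmod z) in Hw.
replace w with ((w - z) + z)%C by ring.
eapply Rle_lt_trans; [apply Cmod_triangle|]. lra.
Qed.

Lemma C_derive_expansion (u : C -> C) (a : nat -> C) :
  has_expansion u a -> has_expansion (C_derive u) (C_PS_derive a).
Proof.
intros Ha z Hz.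
destruct (C_PS_derive_convergent u a z Ha Hz) as [l Hl].
rewrite (is_C_derive_unique u z l); [exact Hl|].
exact (is_derive_expansion u a z l Ha Hz Hl).
Qed.

Lemma analytic_expansion (u : C -> C) (a : nat -> C) : has_expansion u a -> analytic u.
Proof.
intros Ha z Hz.
exists (C_derive u z).
apply (is_derive_expansion u a); trivial. apply C_derive_expansion; assumption.
Qed.

Lemma has_expansion_0 (u : C -> C) (a : nat -> C) : has_expansion u a -> u 0%C = a O.
Proof.
intros Ha.
assert (H0 : disk 0%C) by (unfold disk; rewrite Cmod_0; lra).
apply (filterlim_locally_unique (V := C_NormedModule) (F := eventually) _ _ _ (Ha _ H0)).
apply (is_pseries_0 (V := C_NormedModule)).
Qed.

Lemma has_expansion_ext (u v : C -> C) (a b : nat -> C) :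
  (forall z, disk z -> u z = v z) -> (forall n, a n = b n) ->
  has_expansion u a -> has_expansion v b.
Proof.
intros Huv Hab Ha z Hz. rewrite <- (Huv z Hz).
apply is_pseries_ext with (1 := Hab). exact (Ha z Hz).
Qed.

Lemma has_expansion_plus (u v : C -> C) (a b : nat -> C) :
  has_expansion u a -> has_expansion v b ->
  has_expansion (fun z => u z + v z)%C (fun n => a n + b n)%C.
Proof. intros Ha Hb z Hz. apply (is_pseries_plus (V := C_NormedModule)); auto. Qed.

Lemma has_expansion_scal (c : C) (u : C -> C) (a : nat -> C) :
  has_expansion u a -> has_expansion (fun z => c * u z)%C (fun n => c * a n)%C.
Proof.
intros Ha z Hz. apply (is_pseries_scal (V := C_NormedModule)); auto. apply Cmult_comm.
Qed.

Lemma has_expansion_shift (u : C -> C) (a : nat -> C) :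
  has_expansion u a ->
  has_expansion (fun z => z * u z)%C (fun n => match n with O => 0%C | S m => a m end).
Proof. intros Ha z Hz. apply (is_pseries_incr_1 (V := C_NormedModule) a z), Ha, Hz. Qed.

Lemma has_expansion_const (c : C) :
  has_expansion (fun _ => c) (fun n => match n with O => c | S _ => 0%C end).
Proof.
intros z Hz. apply is_pseries_C.
generalize (is_series_decr_1 (V := C_NormedModule)
  (fun n => (match n with O => c | S _ => 0%C end) * z ^ n)%C c).
intros H. apply H. clear H.
match goal with |- is_series _ ?x => replace x with (@zero C_NormedModule) end.
2:{ change (RtoC 0 = c + - (c * 1))%C. ring. }
apply (is_series_ext (V := C_NormedModule) (fun _ => zero)).
- intros n. change (RtoC 0 = 0 * z ^ S n)%C. ring.
- apply filterlim_ext with (fun _ : nat => @zero C_NormedModule).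
  + intros n. symmetry. apply sum_n_m_const_zero.
  + apply filterlim_const.
Qed.

(** Differentiating and multiplying by z scales the n-th coefficient by n. The hypothesis concerns
    only the derivative of [u], because that is all that two decompositions of the same [f] are
    shown to share. *)
Lemma diff_op_expansion (alpha : R) (u : C -> C) (b : nat -> C) :
  has_expansion (C_derive u) b ->
  has_expansion (diff_op alpha u) (fun n => RtoC (1 - alpha + alpha * INR n) * b n)%C.
Proof.
intros Hb.
assert (H := has_expansion_plus _ _ _ _ (has_expansion_scal (RtoC (1 - alpha)) _ _ Hb)
  (has_expansion_scal (RtoC alpha) _ _ (has_expansion_shift _ _ (C_derive_expansion _ _ Hb)))).
revert H. apply has_expansion_ext.
- intros z Hz. unfold diff_op. ring.
- intros [|n]; unfold C_PS_derive; rewrite RtoC_plus, RtoC_mult.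
  + simpl. ring.
  + ring.
Qed.

Lemma is_derive_C_eps (f : C -> C) (z l : C) (eps : R) :
  0 < eps -> @is_derive C_AbsRing C_NormedModule f z l ->
  exists d, 0 < d /\
    forall w, Cmod (w - z) < d -> Cmod (f w - f z - l * (w - z)) <= eps * Cmod (w - z).
Proof.
intros Heps [_ H].
destruct (H z (fun P HP => HP) (mkposreal _ Heps)) as [d Hd].
exists d. split; [apply cond_pos|]. intros w Hw.
rewrite (Cmult_comm l). exact (Hd w Hw).
Qed.

Lemma Cmod_eq_0_eps (l : C) : (forall eps, 0 < eps -> Cmod l <= eps) -> l = 0%C.
Proof.
intros H. apply Cmod_eq_0. apply Rle_antisym; [|apply Cmod_ge_0].
apply le_epsilon. intros eps Heps. rewrite Rplus_0_l. apply H, Heps.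
Qed.

(* The directions [1] and [Ci] give [l = Cconj m] and [l = - Cconj m]. *)
Lemma is_derive_conj_holomorphic (u v : C -> C) (z l m : C) :
  disk z -> (forall w, disk w -> v w = Cconj (u w)) ->
  @is_derive C_AbsRing C_NormedModule u z l ->
  @is_derive C_AbsRing C_NormedModule v z m -> l = 0%C.
Proof.
intros Hz Huv Hu Hv.
apply Cmod_eq_0_eps. intros eps Heps.
assert (He : 0 < eps / 2) by lra.
destruct (is_derive_C_eps _ _ _ _ He Hu) as [d1 [Hd1 H1]].
destruct (is_derive_C_eps _ _ _ _ He Hv) as [d2 [Hd2 H2]].
destruct (locally_disk z Hz) as [d3 H3].
set (t := Rmin (d3 / 2) (Rmin (d1 / 2) (d2 / 2))).
assert (Ht : 0 < t /\ t < d1 /\ t < d2 /\ t < d3).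
{ assert (Hd3 := cond_pos d3).
  assert (T1 := Rmin_l (d3 / 2) (Rmin (d1 / 2) (d2 / 2))).
  assert (T2 := Rmin_r (d3 / 2) (Rmin (d1 / 2) (d2 / 2))).
  assert (T3 := Rmin_l (d1 / 2) (d2 / 2)). assert (T4 := Rmin_r (d1 / 2) (d2 / 2)).
  fold t in T1, T2.
  assert (T5 : 0 < t) by (unfold t; repeat apply Rmin_pos; lra).
  lra. }
destruct Ht as [Ht0 [Ht1 [Ht2 Ht3]]].
assert (Hdir : forall e, Cmod e = 1 -> Cmod (l * e - Cconj m * Cconj e) <= eps).
{ intros e He1.
  assert (Hte : Cmod (z + t * e - z) = t).
  { replace (z + t * e - z)%C with (t * e)%C by ring.
    rewrite Cmod_mult, He1, Cmod_R, Rabs_pos_eq; lra. }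
  assert (Hd : disk (z + t * e)%C).
  { apply H3. change (Cmod (z + t * e - z) < d3). lra. }
  assert (K1 := H1 (z + t * e)%C ltac:(lra)).
  assert (K2 := H2 (z + t * e)%C ltac:(lra)).
  rewrite Hte in K1, K2. rewrite (Huv z Hz), (Huv _ Hd) in K2.
  (* Conjugating the estimate for [v] gives a second first-order estimate for the same increment [D]
     of [u]; subtracting the two eliminates [D]. *)
  rewrite <- Cmod_conj, <- Cmod_opp in K2.
  rewrite !Cminus_conj, !Cconj_conj, Cmult_conj in K2.
  replace (z + t * e - z)%C with (t * e)%C in K1, K2 by ring.
  rewrite Cmult_conj in K2.
  replace (Cconj t) with (RtoC t) in K2 by (unfold Cconj, RtoC; simpl; f_equal; ring).
  set (D := (u (z + t * e) - u z)%C) in *.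
  apply Rmult_le_reg_l with t; [exact Ht0|].
  replace (t * Cmod (l * e - Cconj m * Cconj e))
    with (Cmod (- (D - l * (t * e)) + - (- (D - Cconj m * (t * Cconj e))))).
  2:{ rewrite <- (Rabs_pos_eq t) at 3 by lra. rewrite <- Cmod_R, <- Cmod_mult.
      f_equal. ring. }
  eapply Rle_trans; [apply Cmod_triangle|].
  rewrite Cmod_opp, (Cmod_opp (- _)). lra. }
assert (K1 := Hdir 1%C Cmod_1).
assert (K2 := Hdir Ci Cmod_Ci).
assert (Hi : Cmod (l * Ci - Cconj m * Cconj Ci) = Cmod (l + Cconj m)).
{ replace (l * Ci - Cconj m * Cconj Ci)%C with (Ci * (l + Cconj m))%C.
  - rewrite Cmod_mult, Cmod_Ci. ring.
  - replace (Cconj Ci) with (- Ci)%C by (unfold Cconj, Ci, Copp; simpl; f_equal; ring). ring. }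
rewrite Hi in K2.
replace (Cconj 1) with (RtoC 1) in K1 by (unfold Cconj, RtoC; simpl; f_equal; ring).
assert (K3 := Cmod_triangle (l * 1 - Cconj m * 1) (l + Cconj m)).
replace (l * 1 - Cconj m * 1 + (l + Cconj m))%C with (2 * l)%C in K3 by ring.
rewrite Cmod_mult, Cmod_R, Rabs_pos_eq in K3; lra.
Qed.

Lemma is_derive_C_minus (u v : C -> C) (z : C) :
  @ex_derive C_AbsRing C_NormedModule u z -> @ex_derive C_AbsRing C_NormedModule v z ->
  @is_derive C_AbsRing C_NormedModule (fun w => u w - v w)%C z (C_derive u z - C_derive v z)%C.
Proof.
intros Hu Hv.
apply (is_derive_minus (V := C_NormedModule)); apply C_derive_correct; trivial; exact 0%C.
Qed.

(** Equating the two decompositions of [f] makes [h1 - h] and [g - g1] conjugate to each other; both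
    are holomorphic, so both derivatives vanish. *)
Lemma canonical_rep_derive_unique (f h g h1 g1 : C -> C) (z : C) :
  canonical_rep f h g -> canonical_rep f h1 g1 -> disk z ->
  C_derive h1 z = C_derive h z /\ C_derive g1 z = C_derive g z.
Proof.
intros [Hh [Hg [_ [_ [_ E]]]]] [Hh1 [Hg1 [_ [_ [_ E1]]]]] Hz.
assert (Dh := is_derive_C_minus h1 h z (Hh1 z Hz) (Hh z Hz)).
assert (Dg := is_derive_C_minus g g1 z (Hg z Hz) (Hg1 z Hz)).
assert (Econj : forall w, disk w -> (h1 w - h w)%C = Cconj (g w - g1 w)).
{ intros w Hw. assert (H := E w Hw). rewrite (E1 w Hw) in H. rewrite Cminus_conj.
  replace (h1 w - h w)%C with (h1 w + Cconj (g1 w) - Cconj (g1 w) - h w)%C by ring.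
  rewrite H. ring. }
assert (Econj' : forall w, disk w -> (g w - g1 w)%C = Cconj (h1 w - h w)).
{ intros w Hw. rewrite Econj, Cconj_conj by exact Hw. reflexivity. }
assert (Zh := is_derive_conj_holomorphic _ _ z _ _ Hz Econj' Dh Dg).
assert (Zg := is_derive_conj_holomorphic _ _ z _ _ Hz Econj Dg Dh).
split.
- replace (C_derive h1 z) with ((C_derive h1 z - C_derive h z) + C_derive h z)%C by ring.
  rewrite Zh. ring.
- replace (C_derive g z) with ((C_derive g z - C_derive g1 z) + C_derive g1 z)%C by ring.
  rewrite Zg. ring.
Qed.

(** * Caratheodory's inequality *)

Definition cis (t : R) : C := (cos t, sin t).

Lemma cis_plus (s t : R) : cis (s + t) = (cis s * cis t)%C.
Proof. unfold cis, Cmult; simpl. rewrite cos_plus, sin_plus. f_equal; ring. Qed.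

Lemma cis_0 : cis 0 = 1%C.
Proof. unfold cis. rewrite cos_0, sin_0. reflexivity. Qed.

Lemma cis_conj (t : R) : Cconj (cis t) = cis (- t).
Proof. unfold cis, Cconj; simpl. rewrite cos_neg, sin_neg. reflexivity. Qed.

Lemma Cmod_cis (t : R) : Cmod (cis t) = 1.
Proof.
unfold Cmod, cis, fst, snd.
replace (cos t ^ 2 + sin t ^ 2) with 1; [apply sqrt_1|].
rewrite <- (sin2_cos2 t). unfold Rsqr. ring.
Qed.

Lemma cis_pow (t : R) (n : nat) : (cis t ^ n)%C = cis (INR n * t).
Proof.
induction n as [|n IH].
- simpl. rewrite Rmult_0_l, cis_0. reflexivity.
- rewrite Cpow_S, IH, <- cis_plus, S_INR. f_equal. ring.
Qed.

Lemma cis_2PI_mult (n : nat) : cis (2 * PI * INR n) = 1%C.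
Proof.
rewrite <- cis_0. unfold cis.
replace (2 * PI * INR n) with (0 + 2 * INR n * PI) by ring.
rewrite cos_period, sin_period. reflexivity.
Qed.

Lemma cis_neq_1 (t : R) : 0 < t < 2 * PI -> cis t <> 1%C.
Proof.
intros Ht H. injection H as Hc _.
assert (Hs : 0 < sin (t / 2)) by (apply sin_gt_0; lra).
replace t with (2 * (t / 2)) in Hc by field.
rewrite cos_2a_sin in Hc. nra.
Qed.

(** A geometric sum with ratio q = e^(2 pi i m / (K + 1)): the bounds on [m] give q <> 1, while
    q^(K+1) = 1. *)
Lemma sum_cis_root (K m : nat) :
  (0 < m < S K)%nat ->
  @sum_n C_AbelianMonoid (fun k => cis (INR m * (2 * PI * INR k / INR (S K)))) K = RtoC 0.
Proof.
intros Hm.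
assert (HK : 0 < INR (S K)) by (apply lt_0_INR; lia).
set (q := cis (2 * PI * INR m / INR (S K))).
assert (Hq : q <> 1%C).
{ apply cis_neq_1.
  assert (H1 : 0 < INR m) by (apply lt_0_INR; lia).
  assert (H2 : INR m < INR (S K)) by (apply lt_INR; lia).
  assert (H3 := PI_RGT_0). split.
  - apply Rdiv_lt_0_compat; nra.
  - apply Rmult_lt_reg_r with (INR (S K)); [exact HK|].
    unfold Rdiv. rewrite Rmult_assoc, Rinv_l by lra. nra. }
assert (Hgeom : forall n, ((1 - q) *
  @sum_n C_AbelianMonoid (fun k => cis (INR m * (2 * PI * INR k / INR (S K)))) n)%C
  = (1 - q ^ S n)%C).
{ assert (Hterm : forall k, cis (INR m * (2 * PI * INR k / INR (S K))) = (q ^ k)%C).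
  { intros k. unfold q. rewrite cis_pow. f_equal. field. lra. }
  induction n as [|n IH].
  - rewrite sum_O, Hterm. simpl. ring.
  - rewrite sum_Sn. change plus with Cplus.
    rewrite Cmult_plus_distr_l, IH, Hterm, (Cpow_S q (S n)). ring. }
assert (HqK : (q ^ S K)%C = 1%C).
{ unfold q. rewrite cis_pow, <- (cis_2PI_mult m). f_equal. field. lra. }
assert (Hz := Hgeom K). rewrite HqK in Hz. at_type C.
assert (H1q : (1 - q)%C <> 0%C).
{ intros H. apply Hq. replace q with (1 - (1 - q))%C by ring. rewrite H. ring. }
match goal with |- ?s = _ => generalize s Hz; intros s0 Hs0 end.
replace s0 with (/ (1 - q) * ((1 - q) * s0))%C by (field; exact H1q).
rewrite Hs0. ring.
Qed.

Lemma sum_cos_root (K m : nat) (c : C) :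
  (0 < m < S K)%nat ->
  sum_n (fun k => Re (c * cis (INR m * (2 * PI * INR k / INR (S K))))) K = 0.
Proof.
intros Hm.
assert (H : forall n, sum_n (fun k => Re (c * cis (INR m * (2 * PI * INR k / INR (S K))))) n
  = Re (c * @sum_n C_AbelianMonoid (fun k => cis (INR m * (2 * PI * INR k / INR (S K)))) n)).
{ induction n as [|n IH].
  - rewrite !sum_O. reflexivity.
  - rewrite !sum_Sn, IH. change (@plus C_AbelianMonoid) with Cplus.
    rewrite Cmult_plus_distr_l. reflexivity. }
rewrite H, sum_cis_root by exact Hm. rewrite Cmult_0_r. reflexivity.
Qed.

Lemma sum_n_R_le (u v : nat -> R) (n : nat) :
  (forall k, u k <= v k) -> sum_n u n <= sum_n v n.
Proof. apply sum_n_m_le. Qed.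

Lemma Re_sum_n (u : nat -> C) (n : nat) :
  Re (@sum_n C_AbelianMonoid u n) = sum_n (fun k => Re (u k)) n.
Proof.
induction n as [|n IH]; [rewrite !sum_O; reflexivity|].
rewrite !sum_Sn, <- IH. reflexivity.
Qed.

(* Only the frequencies [0] and [n] survive the discrete average. *)
Lemma sum_weighted_monomial (K n j : nat) (c v : C) :
  (0 < n)%nat -> (j + n < S K)%nat ->
  sum_n (fun k => Re (c * cis (INR j * (2 * PI * INR k / INR (S K))))
                  * (1 + Re (v * cis (- (INR n * (2 * PI * INR k / INR (S K))))))) K
  = INR (S K) * ((if Nat.eq_dec j 0 then Re c else 0)
                 + (if Nat.eq_dec j n then Re (c * v) / 2 else 0)).
Proof.
intros Hn HK.
set (x := fun k => 2 * PI * INR k / INR (S K)).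
(* Re A Re B = (Re (A B) + Re (A conj B)) / 2 turns the product into frequencies j - n and j + n. *)
assert (Hsplit : forall k,
  Re (c * cis (INR j * x k)) * (1 + Re (v * cis (- (INR n * x k))))
  = plus (Re (c * cis (INR j * x k)))
      (plus (Re ((c * v / 2) * cis ((INR j - INR n) * x k)))
         (Re ((c * Cconj v / 2) * cis (INR (j + n) * x k))))).
{ intros k. change plus with Rplus.
  replace ((INR j - INR n) * x k) with (INR j * x k + - (INR n * x k)) by ring.
  rewrite plus_INR.
  replace ((INR j + INR n) * x k) with (INR j * x k + - - (INR n * x k)) by ring.
  rewrite !cis_plus, <- (cis_conj (- _)).
  set (p := cis (INR j * x k)). set (q := cis (- (INR n * x k))).
  destruct c as [c1 c2], v as [v1 v2], p as [p1 p2], q as [q1 q2].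
  unfold Cdiv, Cinv, Cmult, Cconj, Re, RtoC; simpl. field. }
rewrite (sum_n_ext _ _ _ Hsplit), !sum_n_plus.
change plus with Rplus.
(* Frequency j + n always averages to zero: it lies strictly between 0 and [S K], so there is no
   aliasing. *)
unfold x. rewrite (sum_cos_root K (j + n)) by lia.
destruct (Nat.eq_dec j 0) as [Hj|Hj], (Nat.eq_dec j n) as [Hjn|Hjn]; try lia.
- subst j.
  replace (sum_n (fun k => Re (c * v / 2 * cis ((INR 0 - INR n) * (2 * PI * INR k / INR (S K))))) K)
    with 0.
  (* Conjugating inside the real part turns the negative frequency into a positive one. *)
  2:{ rewrite <- (sum_cos_root K n (Cconj (c * v / 2))) by lia.
      apply sum_n_ext. intros k.
      replace ((INR 0 - INR n) * (2 * PI * INR k / INR (S K)))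
        with (- (INR n * (2 * PI * INR k / INR (S K)))) by (simpl; ring).
      rewrite <- cis_conj, <- (re_conj (_ * Cconj _)), Cmult_conj, Cconj_conj. reflexivity. }
  rewrite (sum_n_ext _ (fun _ => Re c)), sum_n_const.
  + at_type R. ring.
  + intros k. simpl INR. rewrite Rmult_0_l, cis_0, Cmult_1_r. reflexivity.
- rewrite (sum_cos_root K j) by lia. subst j.
  rewrite (sum_n_ext _ (fun _ => Re (c * v) / 2)), sum_n_const.
  + at_type R. ring.
  + intros k. rewrite Rminus_diag, Rmult_0_l, cis_0, Cmult_1_r.
    unfold Cdiv, Cinv, RtoC, Re; simpl. field.
- rewrite (sum_cos_root K j) by lia.
  replace (sum_n (fun k => Re (c * v / 2 * cis ((INR j - INR n) * (2 * PI * INR k / INR (S K))))) K)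
    with 0; [at_type R; ring|].
  destruct (Nat.lt_ge_cases j n) as [Hlt|Hge].
  + rewrite <- (sum_cos_root K (n - j) (Cconj (c * v / 2))) by lia.
    apply sum_n_ext. intros k.
    replace ((INR j - INR n) * (2 * PI * INR k / INR (S K)))
      with (- (INR (n - j) * (2 * PI * INR k / INR (S K)))) by (rewrite minus_INR by lia; ring).
    rewrite <- cis_conj, <- (re_conj (_ * Cconj _)), Cmult_conj, Cconj_conj. reflexivity.
  + rewrite <- (sum_cos_root K (j - n) (c * v / 2)) by lia.
    apply sum_n_ext. intros k. rewrite minus_INR by lia. reflexivity.
Qed.

Lemma exists_unimodular_phase (c : C) : exists v, Cmod v = 1 /\ (c * v)%C = RtoC (Cmod c).
Proof.
destruct (Ceq_dec c 0) as [->|Hc].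
- exists 1%C. split; [exact Cmod_1|]. rewrite Cmod_0. ring.
- assert (Hc0 := proj1 (Cmod_gt_0 c) Hc).
  assert (Hc1 : RtoC (Cmod c) <> 0%C) by (intros H; injection H; lra).
  exists (Cconj c / Cmod c)%C. split.
  + rewrite Cmod_div by exact Hc1. rewrite Cmod_conj, Cmod_R, Rabs_pos_eq by lra. field. lra.
  + unfold Cdiv. rewrite Cmult_assoc, <- Cmod2_conj, RtoC_pow. simpl. field. exact Hc1.
Qed.

(** Against a nonnegative weight of mean 1, Re P averages to Re p_0 - |p_n| r^n / 2, which is
    therefore at least -eps. The slack [eps] will absorb a truncation error. *)
Lemma polynomial_coef_bound (p : nat -> C) (N n : nat) (r eps : R) :
  (0 < n <= N)%nat ->
  (forall t, - eps <= Re (@sum_n C_AbelianMonoid (fun j => p j * (r * cis t) ^ j)%C N)) ->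
  Cmod (p n) * r ^ n <= 2 * (Re (p O) + eps).
Proof.
intros Hn Hlow.
destruct (exists_unimodular_phase (p n)) as [v0 [Hv0 Hpv]].
(* The minus sign makes p_n v = -|p_n|, so that a lower bound on Re P bounds |p_n| from above. *)
set (v := (- v0)%C).
(* Enough sample points for j + n < [S K] whenever j <= N. *)
set (K := (N + n)%nat).
set (x := fun k => 2 * PI * INR k / INR (S K)).
set (w := fun k => 1 + Re (v * cis (- (INR n * x k)))).
assert (HK : 0 < INR (S K)) by (apply lt_0_INR; lia).
assert (Hw : forall k, 0 <= w k).
{ intros k. unfold w.
  assert (H := re_le_Cmod (v * cis (- (INR n * x k)))).
  unfold v in *. rewrite Cmod_mult, Cmod_opp, Hv0, Cmod_cis in H.
  apply Rabs_le_between in H. lra. }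
(* The mean of the weight is the monomial formula for the constant 1, with j = 0. *)
assert (Hsumw : sum_n w K = INR (S K)).
{ rewrite (sum_n_ext _ (fun k => Re (1 * cis (INR 0 * x k)) * w k)).
  - unfold w, x. rewrite (sum_weighted_monomial K n 0 1 v) by lia.
    destruct (Nat.eq_dec 0 n); [lia|]. simpl. ring.
  - intros k. simpl INR. rewrite Rmult_0_l, cis_0, Cmult_1_r. simpl. at_type R. ring. }
assert (Hlower : - eps * INR (S K) <=
  sum_n (fun k => Re (@sum_n C_AbelianMonoid (fun j => p j * (r * cis (x k)) ^ j)%C N) * w k) K).
{ rewrite <- Hsumw, <- (sum_n_scal_l (V := R_NormedModule)).
  apply sum_n_R_le. intros k.
  apply Rmult_le_compat_r; [apply Hw|apply Hlow]. }
assert (Hval : sum_n (fun k =>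
    Re (@sum_n C_AbelianMonoid (fun j => p j * (r * cis (x k)) ^ j)%C N) * w k) K
  = sum_n (fun j => INR (S K) * ((if Nat.eq_dec j 0 then Re (p j * RtoC (r ^ j)) else 0)
        + (if Nat.eq_dec j n then Re (p j * RtoC (r ^ j) * v) / 2 else 0))) N).
{ rewrite (sum_n_ext _ (fun k => sum_n (fun j =>
     Re (p j * RtoC (r ^ j) * cis (INR j * x k)) * w k) N)).
  - rewrite sum_n_switch.
    unfold sum_n at 1 3. apply (sum_n_m_ext_loc (G := R_AbelianMonoid)). intros j Hj.
    apply sum_weighted_monomial; lia.
  - intros k. rewrite Re_sum_n. at_type R.
    rewrite Rmult_comm, <- (sum_n_scal_l (V := R_NormedModule)).
    apply sum_n_ext. intros j. rewrite Cpow_mult_l, cis_pow, RtoC_pow, Cmult_assoc.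
    apply Rmult_comm. }
assert (Hcollapse : forall m, sum_n (fun j => INR (S K) *
      ((if Nat.eq_dec j 0 then Re (p j * RtoC (r ^ j)) else 0)
        + (if Nat.eq_dec j n then Re (p j * RtoC (r ^ j) * v) / 2 else 0))) m
  = INR (S K) * (Re (p O) + (if le_dec n m then Re (p n * RtoC (r ^ n) * v) / 2 else 0))).
{ induction m as [|m IH].
  - rewrite sum_O.
    destruct (Nat.eq_dec 0 0), (Nat.eq_dec 0 n), (le_dec n 0); try lia.
    simpl pow. rewrite Cmult_1_r. reflexivity.
  - rewrite sum_Sn, IH. change plus with Rplus.
    destruct (Nat.eq_dec (S m) 0); [lia|].
    destruct (Nat.eq_dec (S m) n), (le_dec n m), (le_dec n (S m)); try lia; subst; at_type R; ring. }
rewrite Hval, Hcollapse in Hlower.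
destruct (le_dec n N); [|lia].
replace (Re (p n * RtoC (r ^ n) * v)) with (- (Cmod (p n) * r ^ n)) in Hlower.
2:{ replace (p n * RtoC (r ^ n) * v)%C with (- (p n * v0) * RtoC (r ^ n))%C
      by (unfold v; ring).
    rewrite Hpv. simpl. ring. }
assert (H : - eps <= Re (p O) + - (Cmod (p n) * r ^ n) / 2).
{ apply Rmult_le_reg_r with (INR (S K)); [exact HK|]. lra. }
lra.
Qed.

Lemma Bernoulli_one_minus (d : R) (n : nat) : 0 <= d <= 1 -> 1 - INR n * d <= (1 - d) ^ n.
Proof.
intros Hd. induction n as [|n IH].
- simpl. lra.
- rewrite S_INR. simpl. assert (H := pos_INR n).
  assert (H1 := Rmult_le_compat_l (1 - d) _ _ ltac:(lra) IH). nra.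
Qed.

(** On the circle of radius r < 1 a long partial sum of [F] has real part at least -eps / 2, so the
    polynomial bound applies. Then eps tends to 0 and r to 1. *)
Lemma Caratheodory_coef_bound (F : C -> C) (p : nat -> C) (n : nat) :
  has_expansion F p -> (forall z, disk z -> 0 <= Re (F z)) -> (0 < n)%nat ->
  Cmod (p n) <= 2 * Re (p O).
Proof.
intros Hp HF Hn.
assert (Hr : forall r, 0 <= r < 1 -> Cmod (p n) * r ^ n <= 2 * Re (p O)).
{ intros r Hr. apply le_epsilon. intros eps Heps.
  destruct (ex_series_abs_expansion F p r Hp Hr) as [s Hs].
  assert (He : 0 < eps / 2) by lra.
  destruct (proj1 (filterlim_locally_ball_norm _ _) Hs (mkposreal _ He)) as [N0 HN0].
  set (N := Nat.max n N0).
  assert (HN : Rabs (sum_n (fun k => Cmod (p k) * r ^ k) N - s) < eps / 2)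
    by (apply (HN0 N); lia).
  apply Rabs_lt_between in HN.
  replace (2 * Re (p O) + eps) with (2 * (Re (p O) + eps / 2)) by field.
  apply polynomial_coef_bound with N; [lia|].
  intros t. set (z := (r * cis t)%C).
  assert (Hz : Cmod z = r).
  { unfold z. rewrite Cmod_mult, Cmod_cis, Cmod_R, Rabs_pos_eq; lra. }
  assert (Hd : disk z) by (unfold disk; lra).
  assert (Htail := norm_series_tail _ _ _ _ N
    (fun k => Req_le _ _ (eq_trans (Cmod_mult _ _)
       (f_equal (Rmult _) (eq_trans (Cmod_pow z k) (f_equal (fun y => y ^ k) Hz)))))
    (proj1 (is_pseries_C p z _) (Hp z Hd)) Hs).
  assert (HRe := re_le_Cmod (F z - @sum_n C_AbelianMonoid (fun k => p k * z ^ k)%C N)).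
  apply Rabs_le_between in HRe.
  assert (HFz := HF z Hd).
  change (Re (F z - ?S)) with (Re (F z) - Re S) in HRe.
  lra. }
apply le_epsilon. intros e He.
set (A := Cmod (p n) * INR n).
assert (HA : 0 <= A) by (apply Rmult_le_pos; [apply Cmod_ge_0|apply pos_INR]).
(* Chosen so that A d <= e: by Bernoulli's inequality, replacing r^n by 1 at r = 1 - d costs at most
   A d. *)
set (d := e / (A + e)).
assert (Hdpos : 0 < d) by (apply Rdiv_lt_0_compat; lra).
assert (HAd : A * d + e * d = e) by (unfold d; field; lra).
assert (Hd1 : d <= 1) by nra.
assert (H1 := Hr (1 - d) ltac:(lra)).
assert (H2 := Bernoulli_one_minus d n ltac:(lra)).
assert (H3 := Rmult_le_compat_l _ _ _ (Cmod_ge_0 (p n)) H2).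
unfold A in *. nra.
Qed.

(** * Coefficient bounds and the extremal function *)

(** If [va] and [vb] rotate [a] and [b] to the positive axis, then [vb / va] turns [b] into the
    direction of [a]. *)
Lemma exists_phase_aligning (a b : C) :
  exists v, Cmod v = 1 /\ Cmod (a + v * b) = Cmod a + Cmod b.
Proof.
destruct (exists_unimodular_phase a) as [va [Hva Ha]].
destruct (exists_unimodular_phase b) as [vb [Hvb Hb]].
assert (Hva0 : va <> 0%C) by (apply Cmod_gt_0; lra).
exists (vb / va)%C. split.
- rewrite Cmod_div, Hva, Hvb by exact Hva0. field.
- assert (Hab : Cmod (va * (a + vb / va * b)) = Cmod a + Cmod b).
  { replace (va * (a + vb / va * b))%C with (a * va + b * vb)%C by (field; exact Hva0).
    rewrite Ha, Hb, <- RtoC_plus, Cmod_R, Rabs_pos_eq; [reflexivity|].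
    generalize (Cmod_ge_0 a) (Cmod_ge_0 b). lra. }
  rewrite Cmod_mult, Hva in Hab. lra.
Qed.

Lemma Re_mult_unimodular_le (v z : C) : Cmod v = 1 -> - Cmod z <= Re (v * z).
Proof.
intros Hv. assert (H := re_le_Cmod (v * z)). rewrite Cmod_mult, Hv in H.
apply Rabs_le_between in H. lra.
Qed.

(** Factors the denominator into the multiplier that [diff_op] applies to the coefficient of index m
    + 1. *)
Lemma coef_bound_S (alpha M : R) (m : nat) :
  coef_bound alpha M (S m)
  = 2 * (M - alpha + 1) / ((1 - alpha + alpha * INR m) * INR (S m)).
Proof. unfold coef_bound. rewrite !S_INR. f_equal. ring. Qed.

Lemma coef_weight_pos (alpha : R) (m : nat) :
  0 < alpha <= 1 -> (1 <= m)%nat -> 0 < (1 - alpha + alpha * INR m) * INR (S m).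
Proof.
intros Ha Hm. apply le_INR in Hm. simpl in Hm. rewrite S_INR.
apply Rmult_lt_0_compat; nra.
Qed.

Lemma class_P0_coef_sum_bound (alpha M : R) (f h g : C -> C) (a b : nat -> C) (n : nat) :
  0 < alpha <= 1 -> class_P0 alpha M f -> canonical_rep f h g ->
  has_expansion h a -> a 1%nat = RtoC 1 ->
  has_expansion g b -> b 1%nat = RtoC 0 -> (2 <= n)%nat ->
  Cmod (a n) + Cmod (b n) <= coef_bound alpha M n.
Proof.
intros Halpha [h1 [g1 [Hrep1 [_ Hineq]]]] Hrep Ha Ha1 Hb Hb1 Hn.
destruct n as [|m]; [lia|].
destruct (exists_phase_aligning (a (S m)) (b (S m))) as [v [Hv Hab]].
(* The inequality is known for the witnesses [h1], [g1] of class membership, the expansions for [h],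
   [g]; their derivatives coincide on the disk. *)
assert (Hh1 : has_expansion (C_derive h1) (C_PS_derive a)).
{ generalize (C_derive_expansion h a Ha). apply has_expansion_ext; [|reflexivity].
  intros z Hz. symmetry. apply (canonical_rep_derive_unique f h g h1 g1 z); assumption. }
assert (Hg1 : has_expansion (C_derive g1) (C_PS_derive b)).
{ generalize (C_derive_expansion g b Hb). apply has_expansion_ext; [|reflexivity].
  intros z Hz. symmetry. apply (canonical_rep_derive_unique f h g h1 g1 z); assumption. }
assert (HF := has_expansion_plus _ _ _ _ (has_expansion_const (RtoC M))
  (has_expansion_plus _ _ _ _ (diff_op_expansion alpha h1 _ Hh1)
    (has_expansion_scal v _ _ (diff_op_expansion alpha g1 _ Hg1)))).
assert (HC := Caratheodory_coef_bound _ _ m HF).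
cbv beta in HC.
assert (Hpos : forall z, disk z ->
  0 <= Re (RtoC M + (diff_op alpha h1 z + v * diff_op alpha g1 z))).
{ intros z Hz. assert (H1 := Hineq z Hz).
  assert (H2 := Re_mult_unimodular_le v (diff_op alpha g1 z) Hv).
  change (0 <= M + (Re (diff_op alpha h1 z) + Re (v * diff_op alpha g1 z))). lra. }
specialize (HC Hpos ltac:(lia)).
(* As n >= 2, the index m = n - 1 is positive and the constant [M] contributes nothing to that
   coefficient. *)
destruct m as [|m]; [lia|]. cbv iota in HC.
assert (Hw := coef_weight_pos alpha (S m) Halpha ltac:(lia)).
rewrite coef_bound_S.
set (k := (1 - alpha + alpha * INR (S m)) * INR (S (S m))) in *.
apply Rmult_le_reg_l with k; [exact Hw|].
replace (k * (2 * (M - alpha + 1) / k)) with (2 * (M - alpha + 1)) by (field; lra).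
rewrite <- Hab.
replace (k * Cmod (a (S (S m)) + v * b (S (S m)))) with
  (Cmod (0 + (RtoC (1 - alpha + alpha * INR (S m)) * C_PS_derive a (S m)
     + v * (RtoC (1 - alpha + alpha * INR (S m)) * C_PS_derive b (S m))))).
(* With a_1 = 1 and b_1 = 0 the value at the origin is M + (1 - alpha), whatever [v] is. *)
- eapply Rle_trans; [exact HC|]. apply Req_le.
  unfold C_PS_derive. rewrite Ha1, Hb1. destruct v. simpl. ring.
- replace (0 + (RtoC (1 - alpha + alpha * INR (S m)) * C_PS_derive a (S m)
     + v * (RtoC (1 - alpha + alpha * INR (S m)) * C_PS_derive b (S m))))%C
    with (RtoC k * (a (S (S m)) + v * b (S (S m))))%C
    by (unfold k, C_PS_derive; rewrite RtoC_mult; ring).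
  rewrite Cmod_mult, Cmod_R, Rabs_pos_eq; lra.
Qed.

Lemma bounded_coefs_have_sum (a : nat -> C) (B : R) :
  (forall n, Cmod (a n) <= B) -> exists u, has_expansion u a.
Proof.
intros HB.
assert (Hex : forall z, disk z -> exists l, @is_pseries C_AbsRing C_NormedModule a z l).
{ intros z Hz.
  destruct (ex_series_le (V := C_CompleteNormedModule) (fun n => a n * z ^ n)%C
              (fun n => B * Cmod z ^ n)) as [l Hl].
  - intros n. change (Cmod (a n * z ^ n) <= B * Cmod z ^ n).
    rewrite Cmod_mult, Cmod_pow.
    apply Rmult_le_compat_r; [apply pow_le, Cmod_ge_0|apply HB].
  - apply (ex_series_scal (V := R_NormedModule)), ex_series_geom.
    rewrite Rabs_pos_eq by apply Cmod_ge_0. exact Hz.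
  - exists l. apply is_pseries_C. exact Hl. }
(* Choice picks the sum at each point of the disk; the values outside are arbitrary. *)
exists (fun z => epsilon (inhabits (RtoC 0))
  (fun l => @is_pseries C_AbsRing C_NormedModule a z l)).
intros z Hz. apply epsilon_spec, Hex, Hz.
Qed.

Lemma has_expansion_unique (u v : C -> C) (a : nat -> C) (z : C) :
  has_expansion u a -> has_expansion v a -> disk z -> u z = v z.
Proof.
intros Hu Hv Hz.
exact (filterlim_locally_unique (V := C_NormedModule) (F := eventually) _ _ _ (Hu z Hz) (Hv z Hz)).
Qed.

(** The sum u satisfies u = 1 + z u, since both sides have all coefficients equal to 1; solve for
    u. *)
Lemma geometric_expansion : has_expansion (fun z => / (1 - z))%C (fun _ => RtoC 1).
Proof.
destruct (bounded_coefs_have_sum (fun _ => RtoC 1) 1) as [u Hu].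
{ intros _. rewrite Cmod_1. lra. }
generalize Hu. apply has_expansion_ext; [|reflexivity].
intros z Hz.
assert (H : u z = (1 + z * u z)%C).
{ apply (has_expansion_unique u (fun z => 1 + z * u z)%C _ z Hu); [|exact Hz].
  generalize (has_expansion_plus _ _ _ _ (has_expansion_const 1%C) (has_expansion_shift _ _ Hu)).
  apply has_expansion_ext; [reflexivity|]. intros [|n]; ring. }
assert (Hz1 : (1 - z)%C <> 0%C).
{ intros E. unfold disk in Hz.
  replace z with (1 - (1 - z))%C in Hz by ring. rewrite E in Hz.
  replace (1 - 0)%C with (RtoC 1) in Hz by ring. rewrite Cmod_1 in Hz. lra. }
replace (u z) with (/ (1 - z) * (u z - z * u z))%C by (field; exact Hz1).
rewrite H at 1. field. exact Hz1.
Qed.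

(** After clearing the denominator, |1 - z|^2 < 2 (1 - Re z) is the same as |z|^2 < 1. *)
Lemma Re_inv_one_minus (z : C) : disk z -> 1 / 2 < Re (/ (1 - z)).
Proof.
intros Hz. unfold disk in Hz.
assert (H1 := Cmod2_alt z). assert (H0 := Cmod_ge_0 z).
destruct z as [x y]. unfold Re, Im, fst, snd in H1.
assert (Hxy : x ^ 2 + y ^ 2 < 1) by nra.
assert (Hx : x < 1) by nra.
unfold Cinv, Re, Cminus, Cplus, Copp, RtoC, fst, snd.
assert (Hden : 0 < (1 + - x) ^ 2 + (0 + - y) ^ 2) by nra.
apply Rmult_lt_reg_r with ((1 + - x) ^ 2 + (0 + - y) ^ 2); [exact Hden|].
unfold Rdiv at 2. rewrite Rmult_assoc, Rinv_l by lra. nra.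
Qed.

Lemma Cmod_extremal_coef (alpha M : R) (n : nat) :
  0 < M -> 0 < alpha <= 1 -> (2 <= n)%nat ->
  Cmod (extremal_coef alpha M n) = coef_bound alpha M n.
Proof.
intros HM Ha Hn. destruct n as [|[|n]]; try lia. unfold extremal_coef.
rewrite Cmod_R, Rabs_pos_eq; [reflexivity|]. rewrite coef_bound_S.
apply Rlt_le, Rdiv_lt_0_compat; [lra|]. apply coef_weight_pos; [exact Ha|lia].
Qed.

(** The denominators are at least 1; the summand 1 covers the coefficient of index 1. *)
Lemma extremal_coef_bounded (alpha M : R) (n : nat) :
  0 < M -> 0 < alpha <= 1 -> Cmod (extremal_coef alpha M n) <= 1 + 2 * (M - alpha + 1).
Proof.
intros HM Ha. destruct n as [|[|n]].
- simpl. rewrite Cmod_0. lra.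
- simpl. rewrite Cmod_1. lra.
- rewrite Cmod_extremal_coef by (trivial; lia). rewrite coef_bound_S.
  assert (H : 1 <= (1 - alpha + alpha * INR (S n)) * INR (S (S n))).
  { rewrite !S_INR. assert (HN := pos_INR n). nra. }
  apply Rmult_le_reg_r with ((1 - alpha + alpha * INR (S n)) * INR (S (S n))); [lra|].
  unfold Rdiv. rewrite Rmult_assoc, Rinv_l by lra. nra.
Qed.

(** The multipliers cancel the denominators: with c = M - alpha + 1, the coefficients are 1 - alpha
    and then 2 c throughout, so the geometric series sums them. *)
Lemma diff_op_extremal (alpha M : R) (f : C -> C) (z : C) :
  0 < alpha <= 1 -> has_expansion f (extremal_coef alpha M) -> disk z ->
  diff_op alpha f z
  = (RtoC (1 - alpha - 2 * (M - alpha + 1)) + RtoC (2 * (M - alpha + 1)) * / (1 - z))%C.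
Proof.
intros Ha Hf Hz.
refine (has_expansion_unique _ (fun z => _ + _ * / (1 - z))%C _ z
  (diff_op_expansion alpha f _ (C_derive_expansion f _ Hf)) _ Hz).
generalize (has_expansion_plus _ _ _ _
  (has_expansion_const (RtoC (1 - alpha - 2 * (M - alpha + 1))))
  (has_expansion_scal (RtoC (2 * (M - alpha + 1))) _ _ geometric_expansion)).
apply has_expansion_ext; [reflexivity|].
intros [|n]; unfold C_PS_derive.
- simpl. rewrite <- !RtoC_mult, <- !RtoC_plus. f_equal. ring.
- simpl extremal_coef. rewrite coef_bound_S.
  assert (Hw := coef_weight_pos alpha (S n) Ha ltac:(lia)).
  rewrite <- !RtoC_mult, <- !RtoC_plus. f_equal.
  field. split; intros E; rewrite E in Hw; lra.
Qed.

Lemma diff_op_zero (alpha : R) (z : C) : disk z -> diff_op alpha (fun _ => RtoC 0) z = 0%C.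
Proof.
intros Hz.
assert (HD : forall w, C_derive (fun _ => RtoC 0) w = RtoC 0).
{ intros w. apply is_C_derive_unique. apply (is_derive_const (V := C_NormedModule)). }
unfold diff_op. rewrite HD.
rewrite (is_C_derive_unique _ z 0%C).
- ring.
- apply is_derive_ext with (fun _ => RtoC 0); [intros w; symmetry; apply HD|].
  apply (is_derive_const (V := C_NormedModule)).
Qed.

Lemma extremal_canonical_rep (alpha M : R) (f : C -> C) :
  has_expansion f (extremal_coef alpha M) -> canonical_rep f f (fun _ => RtoC 0).
Proof.
intros Hf. repeat split.
- exact (analytic_expansion f _ Hf).
- intros z _. exists (RtoC 0). apply (is_derive_const (V := C_NormedModule)).
- exact (has_expansion_0 f _ Hf).
- rewrite (has_expansion_0 _ _ (C_derive_expansion f _ Hf)). unfold C_PS_derive. simpl. ring.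
- intros z _. rewrite <- (Cplus_0_r (f z)) at 1. f_equal.
  unfold Cconj, RtoC. simpl. f_equal. ring.
Qed.

Theorem theorem2p3 (alpha M : R) (hM : 0 < M) (halpha : 0 < alpha <= 1) :
  (forall (f h g : C -> C) (a b : nat -> C),
     class_P0 alpha M f ->
     canonical_rep f h g ->
     has_expansion h a -> a 0%nat = RtoC 0 -> a 1%nat = RtoC 1 ->
     has_expansion g b -> b 0%nat = RtoC 0 -> b 1%nat = RtoC 0 ->
     forall n : nat, (2 <= n)%nat ->
       Cmod (a n) + Cmod (b n) <= coef_bound alpha M n /\
       Rabs (Cmod (a n) - Cmod (b n)) <= coef_bound alpha M n /\
       Cmod (a n) <= coef_bound alpha M n)
  /\
  (exists f : C -> C,
     has_expansion f (extremal_coef alpha M) /\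
     class_P0 alpha M f /\
     exists (h g : C -> C) (a b : nat -> C),
       canonical_rep f h g /\
       has_expansion h a /\ a 0%nat = RtoC 0 /\ a 1%nat = RtoC 1 /\
       has_expansion g b /\ b 0%nat = RtoC 0 /\ b 1%nat = RtoC 0 /\
       forall n : nat, (2 <= n)%nat ->
         Cmod (a n) + Cmod (b n) = coef_bound alpha M n /\
         Rabs (Cmod (a n) - Cmod (b n)) = coef_bound alpha M n /\
         Cmod (a n) = coef_bound alpha M n).
Proof.
split.
- intros f h g a b Hf Hrep Ha _ Ha1 Hb _ Hb1 n Hn.
  assert (H := class_P0_coef_sum_bound alpha M f h g a b n halpha Hf Hrep Ha Ha1 Hb Hb1 Hn).
  assert (HA := Cmod_ge_0 (a n)). assert (HB := Cmod_ge_0 (b n)).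
  split; [exact H|]. split; [|lra]. apply Rabs_le. lra.
- destruct (bounded_coefs_have_sum (extremal_coef alpha M) (1 + 2 * (M - alpha + 1))) as [f Hf].
  { intros n. apply extremal_coef_bounded; assumption. }
  assert (Hrep := extremal_canonical_rep alpha M f Hf).
  exists f. split; [exact Hf|]. split.
  + exists f, (fun _ => RtoC 0). split; [exact Hrep|]. split.
    * apply is_C_derive_unique. apply (is_derive_const (V := C_NormedModule)).
    * intros z Hz. rewrite diff_op_zero by exact Hz.
      rewrite (diff_op_extremal alpha M f z halpha Hf Hz), Cmod_0.
      (* With c = M - alpha + 1, the real part exceeds 1 - alpha - 2 c + 2 c / 2 = -M. *)
      assert (H := Re_inv_one_minus z Hz).
      replace (Re (RtoC (1 - alpha - 2 * (M - alpha + 1))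
                   + RtoC (2 * (M - alpha + 1)) * / (1 - z)))
        with (1 - alpha - 2 * (M - alpha + 1) + 2 * (M - alpha + 1) * Re (/ (1 - z)))
        by (unfold Re, Cplus, Cmult, RtoC, fst, snd; ring).
      nra.
  + exists f, (fun _ => RtoC 0), (extremal_coef alpha M), (fun _ => RtoC 0).
    split; [exact Hrep|]. split; [exact Hf|]. do 2 (split; [reflexivity|]).
    split.
    { generalize (has_expansion_const 0%C).
      apply has_expansion_ext; [reflexivity|intros [|n]; reflexivity]. }
    do 2 (split; [reflexivity|]).
    intros n Hn. rewrite Cmod_extremal_coef, Cmod_0 by assumption.
    assert (H0 : 0 <= coef_bound alpha M n).
    { rewrite <- (Cmod_extremal_coef alpha M n) by assumption. apply Cmod_ge_0. }
    split; [lra|]. split; [|reflexivity]. rewrite Rminus_0_r. apply Rabs_pos_eq, H0.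
Qed.
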